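(* Let $A$ be a semi-simple commutative Banach algebra. Suppose that $A$ has a bounded weak approximate identity and that $C_{\mathrm{BSE}}(\Delta(A))$ is an ideal of $C_b(\Delta(A))$. Then $$\Delta(C_{\mathrm{BSE}}(\Delta(A)))=\overline{\Delta(A)}^{w^*},$$ where each $\varphi\in\Delta(A)$ is identified with the character $f_\varphi$ of $C_{\mathrm{BSE}}(\Delta(A))$ given by $f_\varphi(\sigma)=\sigma(\varphi)$, and the closure is taken in the weak$^*$ topology of the dual space of the Banach algebra $(C_{\mathrm{BSE}}(\Delta(A)),\|\cdot\|_{\mathrm{BSE}})$.
   Context: All algebras are over $\mathbb{C}$. For a commutative Banach algebra $A$, $\Delta(A)$ (the character space) is the set of all non-zero homomorphisms $A\to\mathbb{C}$, with the relative weak$^*$ (Gelfand) topology from $A^*$. $C_b(\Delta(A))$ is the algebra of bounded continuous complex-valued functions on $\Delta(A)$ with pointwise operations. A function $\sigma\in C_b(\Delta(A))$ is a BSE-function if there is a constant $C>0$ such that for all $\phi_1,\dots,\phi_n\in\Delta(A)$ and all $c_1,\dots,c_n\in\mathbb{C}$, $$\left|\sum_{i=1}^n c_i\sigma(\phi_i)\right|\le C\left\|\sum_{i=1}^n c_i\phi_i\right\|_{A^*}.$$ $C_{\mathrm{BSE}}(\Delta(A))$ is the set of all BSE-functions, and $\|\sigma\|_{\mathrm{BSE}}$ is the infimum of all such constants $C$. It is known (Takahasi–Hatori) that $(C_{\mathrm{BSE}}(\Delta(A)),\|\cdot\|_{\mathrm{BSE}})$ is a semi-simple commutative Banach algebra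 under pointwise operations. A bounded weak approximate identity (b.w.a.i.) for $A$ is a norm-bounded net $\{x_\alpha\}$ in $A$ with $\lim_\alpha\phi(x_\alpha a)=\phi(a)$ for all $\phi\in\Delta(A)$ and $a\in A$; equivalently, $\lim_\alpha\phi(x_\alpha)=1$ for all $\phi\in\Delta(A)$. *)

(* Defs.v *)
From HB Require Import structures.
From mathcomp Require Import all_boot all_order all_algebra.
From mathcomp Require Import complex.
From mathcomp Require Import all_classical all_reals topology normedtype.
From mathcomp Require Import sequences.

Set Implicit Arguments.
Unset Strict Implicit.
Unset Printing Implicit Defensive.

Import Order.TTheory GRing.Theory Num.Theory.
Import numFieldNormedType.Exports.

Local Open Scope classical_set_scope.
Local Open Scope ring_scope.
Local Open Scope complex_scope.

(* R[i] as a normed space over itself, with the topology of the modulus. *)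
HB.instance Definition _ (R : realType) := NormedModule.copy R[i] R[i]^o.

(* The norm of a normed space over R[i] takes its values in R[i]; it is real,
   so that no information is lost by keeping its real part only. *)
Definition normr_re (R : realType) (V : normedModType R[i]) (x : V) : R :=
  complex.Re (`|x| : R[i]).

Section normr_re_theory.
Context {R : realType} {V : normedModType R[i]}.
Implicit Types x y : V.

Lemma normr_reE x : (normr_re x)%:C = `|x|.
Proof. by rewrite /normr_re RRe_real// ger0_real. Qed.

Lemma normr_re_ge0 x : 0 <= normr_re x.
Proof. by rewrite -ler0c normr_reE. Qed.

Lemma normr_reD x y : normr_re (x + y) <= normr_re x + normr_re y.
Proof. by rewrite -lecR rmorphD/= !normr_reE ler_normD. Qed.

Lemma normr_reN x : normr_re (- x) = normr_re x.
Proof. by rewrite /normr_re normrN. Qed.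

Lemma normr_re0 : normr_re (0 : V) = 0.
Proof. by rewrite /normr_re normr0. Qed.

Lemma normr_reZ (c : R[i]) x : normr_re (c *: x) = normr_re c * normr_re x.
Proof.
apply: (fmorph_inj (@real_complex R)).
by rewrite rmorphM/= !normr_reE normrZ.
Qed.

Lemma normr_re_eq0 x : normr_re x = 0 -> x = 0.
Proof. by move=> x0; apply: normr0_eq0; rewrite -normr_reE x0. Qed.

End normr_re_theory.

Lemma normr_reM (R : realType) (x y : R[i]) :
  normr_re (x * y) = normr_re x * normr_re y.
Proof. exact: (@normr_reZ R R[i]). Qed.

Lemma normr_re1 (R : realType) : normr_re (1 : R[i]) = 1.
Proof. by rewrite /normr_re normr1. Qed.

Lemma normr_re_sum (R : realType) (V : normedModType R[i]) (I : Type)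
    (s : seq I) (F : I -> V) :
  normr_re (\sum_(i <- s) F i) <= \sum_(i <- s) normr_re (F i).
Proof.
elim/big_rec2 : _ => [|i a b _ ab]; first by rewrite normr_re0.
by rewrite (le_trans (normr_reD _ _))// lerD2l.
Qed.

Lemma near_normr_re (R : realType) (V : normedModType R[i]) (T : Type)
    (F : set_system T) (FF : Filter F) (f : T -> V) (l : V) :
  f @ F --> l <->
  (forall e : R, 0 < e -> \forall x \near F, normr_re (l - f x) < e).
Proof.
split=> [/cvgrPdist_lt fl e e0|h].
  have := fl e%:C; rewrite ltcR => /(_ e0).
  by apply: filterS => x; rewrite -normr_reE ltcR.
apply/cvgrPdist_lt => e e0.
have eE : e = (complex.Re e)%:C by rewrite RRe_real// gtr0_real.
have /h : 0 < complex.Re e by rewrite -ltcR -eE.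
by apply: filterS => x; rewrite eE -ltcR normr_reE.
Qed.

Lemma cauchy_normr_re (R : realType) (V : normedModType R[i])
    (F : set_system V) (FF : ProperFilter F) :
  cauchy F <-> (forall e : R, 0 < e ->
    exists2 S, F S & forall x y, S x -> S y -> normr_re (x - y) < e).
Proof.
rewrite -cauchy_ballP; split=> [h e e0|h e e0].
  have /h : 0 < e%:C by rewrite ltcR.
  case=> -[/= P Q] [FP FQ] PQ; exists (P `&` Q); first exact: filterI.
  move=> x y [Px _] [_ Qy]; have := PQ (x, y) (conj Px Qy).
  by rewrite /= -ball_normE /= -normr_reE ltcR.
have eE : e = (complex.Re e)%:C by rewrite RRe_real// gtr0_real.
have /h[S FS Sxy] : 0 < complex.Re e by rewrite -ltcR -eE.
exists (S, S) => //= -[x y] [/= Sx Sy].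
by rewrite -ball_normE /= eE -normr_reE ltcR; exact: Sxy.
Qed.

Lemma complex_complete (R : realType) (F : set_system R[i]) :
  ProperFilter F -> cauchy F -> cvg F.
Proof.
move=> FF /cauchy_normr_re Fc.
have ReD (x y : R[i]) : complex.Re (x - y) = complex.Re x - complex.Re y
  by rewrite raddfB.
have ImD (x y : R[i]) : complex.Im (x - y) = complex.Im x - complex.Im y
  by rewrite raddfB.
have h (p : R[i] -> R) : (forall x y, p (x - y) = p x - p y) ->
    (forall x, `|p x| <= normr_re x) -> cvg (p @ F).
  move=> pB pn; apply/cauchy_cvgP/cauchy_ballP => e e0.
  have [S FS Sxy] := Fc _ e0.
  exists (p @` S, p @` S).
    by split; apply: (@filterS _ F _ S) => // x Sx; exists x.
  move=> [_ _] [/= [x Sx <-] [y Sy <-]]; rewrite -ball_normE /= -pB.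
  exact: le_lt_trans (pn _) (Sxy _ _ Sx Sy).
have ReN (x : R[i]) : `|complex.Re x| <= normr_re x.
  by rewrite -lecR normr_reE normc_ge_Re.
have ImN (x : R[i]) : `|complex.Im x| <= normr_re x.
  rewrite -lecR normr_reE normc_def lecR -sqrtr_sqr ler_sqrt ?lerDr ?sqr_ge0//.
  by rewrite addr_ge0 ?sqr_ge0.
have /cvg_ex[/= a Fa] := h _ ReD ReN.
have /cvg_ex[/= b Fb] := h _ ImD ImN.
apply/cvg_ex; exists (a +i* b).
apply/(@near_normr_re R R[i] R[i] F _ id) => e e0.
have e20 : 0 < e / 2 by rewrite divr_gt0.
near=> x.
have xab : (a +i* b) - x = (a - complex.Re x)%:C + 'i%C * (b - complex.Im x)%:C.
  by rewrite [LHS]complexE ReD ImD.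
rewrite xab (le_lt_trans (normr_reD _ _))// normr_reM.
have -> : normr_re ('i%C : R[i]) = 1.
  by rewrite /normr_re normc_def/= expr0n/= expr1n add0r sqrtr1.
have rC (r : R) : normr_re r%:C = `|r|.
  by rewrite /normr_re normc_def/= expr0n/= addr0 sqrtr_sqr.
rewrite mul1r !rC (splitr e) ltrD//; near: x.
- by move/cvgrPdist_lt : Fa; exact.
- by move/cvgrPdist_lt : Fb; exact.
Unshelve. all: by end_near. Qed.

HB.instance Definition _ (R : realType) :=
  Uniform_isComplete.Build R[i] (@complex_complete R).

(* Commutative complex Banach algebras; no unit is assumed. *)
HB.mixin Record isComBanachAlgebra (R : realType) A
    & CompleteNormedModule R[i] A := {
  bmul : A -> A -> A ;
  bmulA : associative bmul ;
  bmulC : commutative bmul ;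
  bmulDl : left_distributive bmul +%R ;
  bmulZl : forall (c : R[i]) x y, bmul (c *: x) y = c *: bmul x y ;
  bnormM : forall x y, `|bmul x y| <= `|x| * `|y| :> R[i]
}.

#[short(type="comBanachAlgType")]
HB.structure Definition ComBanachAlgebra (R : realType) :=
  {A of isComBanachAlgebra R A & CompleteNormedModule R[i] A}.

Section spaces.
Context {R : realType}.

(* All non-zero homomorphisms; continuity is not required but automatic, see
   character_le below. *)
Definition character (A : comBanachAlgType R) : set {ptws A -> R[i]} :=
  [set f | [/\ forall (c : R[i]) x y, f (c *: x + y) = c * f x + f y,
              forall x y, f (bmul x y) = f x * f y
            & exists x, f x != 0]].

Definition dual_space (V : normedModType R[i]) : set {ptws V -> R[i]} :=
  [set f | (forall (c : R[i]) x y, f (c *: x + y) = c * f x + f y) /\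
           continuous (f : V -> R[i])].

Definition dual_norm (V : normedModType R[i]) (f : V -> R[i]) : R :=
  sup [set normr_re (f x) | x in [set x | normr_re x <= 1]].

End spaces.
Arguments character {R} A _.
Arguments dual_space {R} V _.

(* Both types carry the topology induced by {ptws _ -> R[i]}, the topology of
   pointwise convergence. On Dual V it is the weak* topology; on Delta A it is
   the relative weak* topology, as Delta A is contained in Dual A. *)
Notation Delta A := (set_type (character A)).
Notation Dual V := (set_type (dual_space V)).

Section BSE.
Context {R : realType} (A : comBanachAlgType R).
Implicit Types (s t : Delta A -> R[i]) (C : R).

Definition Cb : set (Delta A -> R[i]) :=
  [set s | continuous s /\ exists M : R, forall phi, normr_re (s phi) <= M].

Definition BSE_bound s C : Prop :=
  forall (n : nat) (phi : 'I_n -> Delta A) (c : 'I_n -> R[i]),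
    normr_re (\sum_(i < n) c i * s (phi i)) <=
    C * dual_norm (fun a : A => \sum_(i < n) c i * \val (phi i) a).

Definition BSE_function : set (Delta A -> R[i]) :=
  [set s | Cb s /\ exists2 C, 0 < C & BSE_bound s C].

Definition BSE_norm s : R := inf [set C | 0 < C /\ BSE_bound s C].

End BSE.
Arguments Cb {R} A _.
Arguments BSE_function {R} A _.

Section automatic_continuity.
Context {R : realType} (A : comBanachAlgType R).
Implicit Types (x y a : A).

Lemma bnormrM x y : normr_re (bmul x y) <= normr_re x * normr_re y.
Proof. rewrite -lecR rmorphM/= !normr_reE. exact: bnormM. Qed.

Lemma bmulZr (c : R[i]) x y : bmul x (c *: y) = c *: bmul x y.
Proof. by rewrite bmulC bmulZl bmulC. Qed.

Lemma bmulDr x y a : bmul a (x + y) = bmul a x + bmul a y.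
Proof. by rewrite bmulC bmulDl ![bmul _ a]bmulC. Qed.

Lemma bmulBr x y a : bmul a (x - y) = bmul a x - bmul a y.
Proof. by rewrite bmulDr -scaleN1r bmulZr scaleN1r. Qed.

Lemma bmul0r a : bmul 0 a = 0.
Proof. by rewrite -(scale0r (0 : A)) bmulZl !scale0r. Qed.

Lemma bmulr0 a : bmul a 0 = 0.
Proof. by rewrite bmulC bmul0r. Qed.

Lemma quasi_inverse a : normr_re a < 1 -> exists b, b = a + bmul a b.
Proof.
move=> a1; pose q := normr_re a; have q0 : 0 <= q by exact: normr_re_ge0.
pose f b := a + bmul a b; pose u n := iter n f 0.
have fB x y : normr_re (f x - f y) <= q * normr_re (x - y).
  by rewrite /f opprD addrACA subrr add0r -bmulBr bnormrM.
have u1 n m : normr_re (u n - u (n + m)%N) <= q ^+ n * (q / (1 - q)).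
  elim: n => [|n IH].
    rewrite expr0 mul1r sub0r normr_reN add0n.
    have p0 : 0 < 1 - q by rewrite subr_gt0.
    elim: m => [|m IH]; first by rewrite normr_re0 divr_ge0// ltW.
    rewrite (le_trans (normr_reD _ _))//.
    rewrite (le_trans (lerD (lexx q) (bnormrM _ _)))//.
    rewrite (le_trans (lerD (lexx q) (ler_wpM2l q0 IH)))//.
    rewrite le_eqVlt; apply/orP; left; apply/eqP.
    apply: (mulIf (lt0r_neq0 p0)).
    by rewrite mulrDl -!mulrA mulVf ?lt0r_neq0// !mulr1 mulrBr mulr1 subrK.
  by rewrite addSn exprS -mulrA (le_trans (fB _ _))// ler_wpM2l.
have u2 : cvg (u n @[n --> \oo]).
  apply/cauchy_cvgP/cauchy_normr_re => e e0.
  have K0 : 0 < q / (1 - q) + 1.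
    by rewrite ltr_wpDl// divr_ge0// ltW// subr_gt0.
  have : q ^+ n @[n --> \oo] --> 0.
    have := @cvg_geometric R 1 q; rewrite ger0_norm// => /(_ a1).
    apply: cvg_trans; apply: near_eq_cvg.
    by near=> n; rewrite /geometric/= mul1r.
  move=> /cvgrPdist_lt /(_ (e / 2 / (q / (1 - q) + 1))).
  rewrite !divr_gt0// => /(_ isT) [N _ /(_ N (leqnn N))/=].
  rewrite sub0r normrN ger0_norm ?exprn_ge0// ltr_pdivlMr// => qN.
  have uN m : (N <= m)%N -> normr_re (u N - u m) < e / 2.
    move=> /subnKC <-; apply: le_lt_trans qN.
    apply: (le_trans (u1 _ _)); rewrite ler_wpM2l ?exprn_ge0//.
    by rewrite lerDl.
  exists (u @` [set m | (N <= m)%N]).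
    by exists N => // m /= Nm; exists m.
  move=> _ _ [m Nm <-] [k Nk <-].
  have -> : u m - u k = - (u N - u m) + (u N - u k).
    by rewrite opprB addrA subrK.
  rewrite (le_lt_trans (normr_reD _ _))// normr_reN (splitr e) ltrD//;
    exact: uN.
move: u2 => /cvg_ex[/= b ub]; exists b.
apply/eqP; rewrite -subr_eq0; apply/eqP/normr_re_eq0.
apply/eqP; rewrite eq_le normr_re_ge0 andbT; apply/ler_addgt0Pr => e e0.
rewrite add0r.
have e20 : 0 < e / 2 by rewrite divr_gt0.
have /(near_normr_re _ _ _).1/(_ _ e20) [N _ uN] := ub.
have h1 := uN N (leqnn N); have h2 := uN N.+1 (leqnSn N).
have -> : b - (a + bmul a b) = (b - u N.+1) + (f (u N) - f b).
  by rewrite addrA subrK.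
rewrite (le_trans (normr_reD _ _))// (splitr e) lerD//; first exact: ltW.
rewrite (le_trans (fB _ _))// -[leRHS]mul1r ler_pM ?normr_re_ge0// ltW//.
by rewrite -normr_reN opprB.
Unshelve. all: by end_near. Qed.

Lemma character_le (f : A -> R[i]) :
  character A f -> forall x, normr_re (f x) <= normr_re x.
Proof.
move=> [flin fM _] x; rewrite leNgt; apply/negP => xfx.
have fx0 : f x != 0.
  by apply/eqP => fx0; move: xfx; rewrite fx0 normr_re0 ltNge normr_re_ge0.
have f0 : f 0 = 0.
  have := flin (-1) 0 0; by rewrite scaler0 addr0 mulN1r addNr.
have fZ c y : f (c *: y) = c * f y by rewrite -[c *: y]addr0 flin f0 addr0.
have fD y z : f (y + z) = f y + f z by rewrite -[y]scale1r flin mul1r scale1r.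
have nfx0 : 0 < normr_re (f x) by exact: le_lt_trans (normr_re_ge0 _) xfx.
have : normr_re ((f x)^-1 *: x) < 1.
  rewrite normr_reZ -(ltr_pM2l nfx0) mulrA -normr_reM mulfV// normr_re1.
  by rewrite mul1r mulr1.
move=> /quasi_inverse[b] /(congr1 f); rewrite fD fM fZ mulVf// mul1r.
by move/eqP; rewrite -subr_eq subrr eq_sym oner_eq0.
Qed.

End automatic_continuity.

Section BSE_theory.
Context {R : realType} (A : comBanachAlgType R).
Implicit Types (s t : Delta A -> R[i]) (C : R).

Let comb n (phi : 'I_n -> Delta A) (c : 'I_n -> R[i]) (a : A) : R[i] :=
  \sum_(i < n) c i * \val (phi i) a.

Lemma Delta_character (phi : Delta A) : character A (\val phi).
Proof. exact/set_mem/valP. Qed.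

Lemma Delta_lin (phi : Delta A) (c : R[i]) x y :
  \val phi (c *: x + y) = c * \val phi x + \val phi y.
Proof. by have [+ _ _] := Delta_character phi; exact. Qed.

Lemma Delta_mul (phi : Delta A) x y :
  \val phi (bmul x y) = \val phi x * \val phi y.
Proof. by have [_ + _] := Delta_character phi; exact. Qed.

Lemma Delta0 (phi : Delta A) : \val phi 0 = 0.
Proof.
by have := Delta_lin phi (-1) 0 0; rewrite scaler0 addr0 mulN1r addNr.
Qed.

Let dual_set_neq0 (f : A -> R[i]) :
  [set normr_re (f x) | x in [set x | normr_re x <= 1]] !=set0.
Proof. by exists (normr_re (f 0)), 0 => //=; rewrite normr_re0. Qed.

Lemma dual_norm_le (f : A -> R[i]) (K : R) :
  (forall a, normr_re a <= 1 -> normr_re (f a) <= K) -> dual_norm f <= K.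
Proof. by move=> h; apply: ge_sup => // _ [a a1 <-]; exact: h. Qed.

Lemma comb_le n (phi : 'I_n -> Delta A) c a :
  normr_re a <= 1 -> normr_re (comb phi c a) <= dual_norm (comb phi c).
Proof.
move=> a1; apply: ub_le_sup; last by exists a.
exists (\sum_(i < n) normr_re (c i)) => _ [x x1 <-].
rewrite (le_trans (normr_re_sum _ _))//; apply: ler_sum => i _.
rewrite normr_reM -[leRHS]mulr1 ler_wpM2l ?normr_re_ge0//.
exact: le_trans (character_le (Delta_character _) _) x1.
Qed.

Lemma dual_norm_ge0 n (phi : 'I_n -> Delta A) c : 0 <= dual_norm (comb phi c).
Proof.
apply: le_trans (@comb_le _ phi c 0 _); first exact: normr_re_ge0.
by rewrite normr_re0.
Qed.

Lemma BSE_bound_pointwise s C phi :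
  0 <= C -> BSE_bound s C -> normr_re (s phi) <= C.
Proof.
move=> C0 /(_ 1 (fun=> phi) (fun=> 1)); rewrite big_ord1 mul1r => /le_trans.
apply; rewrite -[leRHS]mulr1 ler_wpM2l//; apply: dual_norm_le => a a1.
rewrite big_ord1 mul1r.
exact: le_trans (character_le (Delta_character _) _) a1.
Qed.

Lemma BSE_boundW s C D : C <= D -> BSE_bound s C -> BSE_bound s D.
Proof.
move=> CD sC n phi c; apply: le_trans (sC _ _ _) _.
by rewrite ler_wpM2r// dual_norm_ge0.
Qed.

Lemma BSE_bound0 : BSE_bound (0 : Delta A -> R[i]) 0.
Proof.
move=> n phi c; rewrite mul0r big1; last by move=> i _; rewrite /= mulr0.
by rewrite normr_re0.
Qed.

Lemma BSE_boundD s t C D :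
  BSE_bound s C -> BSE_bound t D -> BSE_bound (s + t) (C + D).
Proof.
move=> sC tD n phi c; rewrite mulrDl.
under eq_bigr do rewrite /= mulrDr.
rewrite big_split/= (le_trans (normr_reD _ _))//.
by apply: lerD; [exact: sC|exact: tD].
Qed.

Lemma BSE_boundZ (k : R[i]) s C :
  BSE_bound s C -> BSE_bound (k *: s) (normr_re k * C).
Proof.
move=> sC n phi c.
rewrite (eq_bigr (fun i => k * (c i * s (phi i)))); last first.
  by move=> i _; exact: mulrCA.
rewrite -mulr_sumr normr_reM -mulrA ler_wpM2l ?normr_re_ge0//.
exact: sC.
Qed.

Lemma BSE_boundM s t C D : 0 <= C -> 0 <= D ->
  BSE_bound s C -> BSE_bound t D -> BSE_bound (s * t) (C * D).
Proof.
move=> C0 D0 sC tD n phi c.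
rewrite (eq_bigr (fun i => c i * t (phi i) * s (phi i))); last first.
  by move=> i _; rewrite -mulrA (mulrC (t _)).
apply: (le_trans (sC _ _ _)); rewrite -mulrA ler_wpM2l//.
apply: dual_norm_le => a a1.
under eq_bigr do rewrite mulrAC.
apply: (le_trans (tD _ _ _)); rewrite ler_wpM2l//.
apply: dual_norm_le => b b1.
under eq_bigr do rewrite -mulrA -Delta_mul.
apply: (comb_le phi c); rewrite (le_trans (bnormrM _ _))//.
by rewrite -[leRHS]mulr1 ler_pM ?normr_re_ge0.
Qed.

Let BSE_set s := [set C | 0 < C /\ BSE_bound s C].

Let BSE_set_lb s : has_lbound (BSE_set s).
Proof. by exists 0 => C [/ltW C0 _]. Qed.

Lemma BSE_norm_ge0 s : 0 <= BSE_norm s.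
Proof.
have [[C hC]|h] := pselect (BSE_set s !=set0).
  by apply: lb_le_inf; [exists C|move=> D [/ltW D0 _]].
by rewrite /BSE_norm inf_out// => -[[C hC] _]; apply: h; exists C.
Qed.

Lemma BSE_norm_le s C : 0 <= C -> BSE_bound s C -> BSE_norm s <= C.
Proof.
move=> C0 sC; apply/ler_addgt0Pr => e e0.
  apply: (ge_inf (BSE_set_lb s)); split.
  by rewrite ltr_wpDl.
by apply: BSE_boundW sC; rewrite lerDl ltW.
Qed.

Lemma BSE_norm_bound s : BSE_function A s -> BSE_bound s (BSE_norm s).
Proof.
move=> [_ [C0 C00 sC0]] n phi c.
have := dual_norm_ge0 phi c; rewrite /comb le_eqVlt => /orP[/eqP d0|d0].
  by have := sC0 n phi c; rewrite -d0 !mulr0.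
rewrite -ler_pdivrMr//; apply: lb_le_inf; first by exists C0.
by move=> C [_ sC]; rewrite ler_pdivrMr.
Qed.

Lemma BSE_norm_pointwise s phi :
  BSE_function A s -> normr_re (s phi) <= BSE_norm s.
Proof.
by move=> /BSE_norm_bound; apply: BSE_bound_pointwise; exact: BSE_norm_ge0.
Qed.

Lemma BSE_functionP s :
  BSE_function A s <-> continuous s /\ exists2 C, 0 <= C & BSE_bound s C.
Proof.
split=> [[[sc _] [C C0 sC]]|[sc [C C0 sC]]].
  by split=> //; exists C => //; exact: ltW.
split; first by split=> //; exists C => phi; exact: BSE_bound_pointwise.
by exists (C + 1); [rewrite ltr_wpDl//|apply: BSE_boundW sC; rewrite lerDl].
Qed.

Lemma BSE_function0 : BSE_function A 0.
Proof.
apply/BSE_functionP; split; last by exists 0 => //; exact: BSE_bound0.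
by move=> phi; exact: (@cvg_cst R[i] 0 (Delta A) (nbhs phi) _).
Qed.

Lemma BSE_functionD s t :
  BSE_function A s -> BSE_function A t -> BSE_function A (s + t).
Proof.
move=> /BSE_functionP[sc [C C0 sC]] /BSE_functionP[tc [D D0 tD]].
apply/BSE_functionP; split.
  by move=> phi; exact: (cvgD (sc phi) (tc phi)).
by exists (C + D); [rewrite addr_ge0|exact: BSE_boundD].
Qed.

Lemma BSE_functionM s t :
  BSE_function A s -> BSE_function A t -> BSE_function A (s * t).
Proof.
move=> /BSE_functionP[sc [C C0 sC]] /BSE_functionP[tc [D D0 tD]].
apply/BSE_functionP; split.
  by move=> phi; exact: (cvgM (sc phi) (tc phi)).
by exists (C * D); [rewrite mulr_ge0|exact: BSE_boundM].
Qed.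

Lemma BSE_functionZ (k : R[i]) s : BSE_function A s -> BSE_function A (k *: s).
Proof.
move=> /BSE_functionP[sc [C C0 sC]].
apply/BSE_functionP; split.
  move=> phi.
  exact: (cvgM (@cvg_cst R[i] k (Delta A) (nbhs phi) _) (sc phi)).
by exists (normr_re k * C); [rewrite mulr_ge0 ?normr_re_ge0|exact: BSE_boundZ].
Qed.

Definition BSE_pred : {pred Delta A -> R[i]} := mem (BSE_function A).

Lemma BSE_submod_closed : submod_closed BSE_pred.
Proof.
split=> [|k s t]; first by rewrite inE; exact: BSE_function0.
by rewrite !inE => sB tB; apply: BSE_functionD => //; exact: BSE_functionZ.
Qed.

HB.instance Definition _ :=
  GRing.isSubmodClosed.Build R[i] (Delta A -> R[i]) BSE_pred BSE_submod_closed.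

End BSE_theory.
Arguments BSE_pred {R} A.

(* The Banach algebra of BSE-functions: pointwise operations, norm BSE_norm. *)
Record CBSE (R : realType) (A : comBanachAlgType R) := MkCBSE {
  CBSE_val :> Delta A -> R[i] ;
  _ : CBSE_val \in BSE_pred A }.

Section CBSE_algebra.
Context {R : realType} (A : comBanachAlgType R).

HB.instance Definition _ := [isSub for @CBSE_val R A].
HB.instance Definition _ := [Choice of CBSE A by <:].
HB.instance Definition _ := [SubChoice_isSubLmodule of CBSE A by <:].

Implicit Types s t : CBSE A.

Lemma CBSE_function s : BSE_function A s.
Proof. exact/set_mem/(valP s). Qed.

Let norm s : R[i] := (BSE_norm s)%:C.

Let ler_normD s t : norm (s + t) <= norm s + norm t.
Proof.
rewrite -rmorphD/= lecR; apply: BSE_norm_le.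
  by rewrite addr_ge0 ?BSE_norm_ge0.
by apply: BSE_boundD; exact/BSE_norm_bound/CBSE_function.
Qed.

Let norm_le (k : R[i]) s :
  BSE_norm (k *: s : CBSE A) <= normr_re k * BSE_norm s.
Proof.
apply: BSE_norm_le; first by rewrite mulr_ge0 ?normr_re_ge0 ?BSE_norm_ge0.
by apply: BSE_boundZ; exact/BSE_norm_bound/CBSE_function.
Qed.

Let normrZ (k : R[i]) s : norm (k *: s) = `|k| * norm s.
Proof.
rewrite -normr_reE -rmorphM/=; congr (_%:C); apply/eqP; rewrite eq_le norm_le/=.
have [->|k0] := eqVneq k 0; first by rewrite normr_re0 mul0r BSE_norm_ge0.
have k0' : 0 < normr_re k.
  rewrite lt_neqAle normr_re_ge0 andbT eq_sym.
  by apply: contra_neq k0; exact: normr_re_eq0.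
have kV : normr_re k * normr_re k^-1 = 1.
  by rewrite -normr_reM mulfV// normr_re1.
have := norm_le k^-1 (k *: s); rewrite scalerA mulVf// scale1r.
by move=> /(ler_wpM2l (ltW k0')) /le_trans; apply; rewrite mulrA kV mul1r.
Qed.

Let normr0_eq0 s : norm s = 0 -> s = 0.
Proof.
move=> s0; apply/val_inj/funext => phi; apply: normr_re_eq0; apply/eqP.
rewrite eq_le normr_re_ge0 andbT.
have <- : BSE_norm s = 0 by apply: (fmorph_inj (@real_complex R)).
exact/BSE_norm_pointwise/CBSE_function.
Qed.

HB.instance Definition _ := @Lmodule_isNormed.Build R[i] (CBSE A)
  norm ler_normD normrZ normr0_eq0.

Lemma CBSE_normE s : `|s| = (BSE_norm s)%:C.
Proof. by []. Qed.

Lemma normr_re_CBSE s : normr_re s = BSE_norm s.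
Proof. by []. Qed.

Lemma CBSE_complete (F : set_system (CBSE A)) :
  ProperFilter F -> cauchy F -> cvg F.
Proof.
move=> FF /cauchy_normr_re Fc.
have Bw s t (e : R) : normr_re (s - t) < e -> BSE_bound (s - t : CBSE A) e.
  move=> /ltW ste; apply: BSE_boundW (ste) _.
  exact/BSE_norm_bound/CBSE_function.
have cF phi : cvg ((fun s : CBSE A => s phi) @ F).
  apply: complex_complete; apply/cauchy_normr_re => e /Fc[S FS Sst].
  exists ((fun s : CBSE A => s phi) @` S).
    by apply: (@filterS _ F _ S) => // s Ss; exists s.
  move=> _ _ [s Ss <-] [t St <-]; apply: le_lt_trans (Sst _ _ Ss St).
  exact: (BSE_norm_pointwise _ (CBSE_function (s - t))).
pose l phi : R[i] := lim ((fun s : CBSE A => s phi) @ F).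
have Fl phi : (fun s : CBSE A => s phi) @ F --> l phi by exact: cF.
have key (e : R) (S : set (CBSE A)) : F S ->
    (forall s t, S s -> S t -> normr_re (s - t) < e) ->
    forall s, S s -> BSE_bound ((s : Delta A -> R[i]) - l) e.
  move=> FS Sst s Ss n phi c; apply/ler_addgt0Pr => d d0.
  have : (fun t : CBSE A => \sum_(i < n) c i * (s (phi i) - t (phi i))) @ F -->
         \sum_(i < n) c i * (s (phi i) - l (phi i)).
    apply: cvg_big => [|i _]; first exact: add_continuous.
    apply: cvgM; first exact: cvg_cst.
    by apply: cvgB; [exact: cvg_cst|exact: Fl].
  move=> /(near_normr_re _ _ _).1/(_ _ d0) Fd.
  have [t [St td]] := filter_ex (filterI FS Fd).
  rewrite -[X in normr_re X](subrK
    (\sum_(i < n) c i * (s (phi i) - t (phi i)))).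
  rewrite (le_trans (normr_reD _ _))// addrC lerD//; last exact: ltW.
  by have := Bw _ _ _ (Sst _ _ Ss St) n phi c.
have lB : BSE_function A l.
  have [S FS Sst] := Fc _ ltr01.
  have [s Ss] := filter_ex FS.
  have [sc [C C0 sC]] := (BSE_functionP _).1 (CBSE_function s).
  apply/BSE_functionP; split; last first.
    have -> : l = (s : Delta A -> R[i]) + (-1) *: ((s : Delta A -> R[i]) - l).
      by rewrite scaleN1r opprB addrC subrK.
    exists (C + normr_re (-1 : R[i]) * 1).
      by rewrite addr_ge0// mulr_ge0 ?normr_re_ge0.
    apply: BSE_boundD => //; apply: BSE_boundZ; exact: key Ss.
  move=> phi.
  apply: (@near_normr_re R R[i] (Delta A) (nbhs phi) _ l (l phi)).2 => e e0.
  have e30 : 0 < e / 3 by rewrite divr_gt0.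
  have [T FT Tst] := Fc _ e30; have [t Tt] := filter_ex FT.
  have tl psi : normr_re (t psi - l psi) <= e / 3.
    exact: (BSE_bound_pointwise psi (ltW e30) (key _ _ FT Tst _ Tt)).
  have [tc _] := (BSE_functionP _).1 (CBSE_function t).
  have := (@near_normr_re R R[i] (Delta A) (nbhs phi) _ t (t phi)).1
    (tc phi) _ e30 => tphi0; near=> psi.
  have tphi : normr_re (t phi - t psi) < e / 3 by near: psi; exact: tphi0.
  have -> : l phi - l psi =
      - (t phi - l phi) + (t phi - t psi) + (t psi - l psi).
    by rewrite opprB !addrA !subrK.
  have -> : e = e / 3 + e / 3 + e / 3.
    by rewrite -mulr2n -mulrSr -(mulr_natr (e / 3) 3) divfK ?pnatr_eq0.
  rewrite (le_lt_trans (normr_reD _ _))// ltr_leD//.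
  by rewrite (le_lt_trans (normr_reD _ _))// ler_ltD// normr_reN.
have lP : l \in BSE_pred A by rewrite inE.
apply/cvg_ex; exists (MkCBSE lP).
apply/(@near_normr_re R (CBSE A) (CBSE A) F _ id) => e e0.
have e20 : 0 < e / 2 by rewrite divr_gt0.
have [S FS Sst] := Fc _ e20; near=> s; have Ss : S s by near: s.
rewrite -normr_reN opprB normr_re_CBSE.
apply: (@le_lt_trans _ _ (e / 2)); last first.
  by rewrite ltr_pdivrMr// ltr_pMr// ltr1n.
by apply: BSE_norm_le; [exact: ltW|exact: key Ss].
Unshelve. all: by end_near. Qed.

HB.instance Definition _ := Uniform_isComplete.Build (CBSE A) CBSE_complete.

Lemma CBSE_mul_subproof s t :
  (s : Delta A -> R[i]) * (t : Delta A -> R[i]) \in BSE_pred A.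
Proof. by rewrite inE; apply: BSE_functionM; exact: CBSE_function. Qed.

Definition CBSE_mul s t : CBSE A := MkCBSE (CBSE_mul_subproof s t).

Let mulA : associative CBSE_mul.
Proof. by move=> s t u; apply/val_inj; rewrite /= mulrA. Qed.

Let mulC : commutative CBSE_mul.
Proof. by move=> s t; apply/val_inj; rewrite /= mulrC. Qed.

Let mulDl : left_distributive CBSE_mul +%R.
Proof. by move=> s t u; apply/val_inj; rewrite /= mulrDl. Qed.

Let mulZl (c : R[i]) s t : CBSE_mul (c *: s) t = c *: CBSE_mul s t.
Proof. by apply/val_inj/funext => phi /=; rewrite -[LHS]mulrA. Qed.

Let normM s t : `|CBSE_mul s t| <= `|s| * `|t| :> R[i].
Proof.
rewrite !CBSE_normE -rmorphM/= lecR; apply: BSE_norm_le.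
  by rewrite mulr_ge0 ?BSE_norm_ge0.
by apply: BSE_boundM; rewrite ?BSE_norm_ge0//;
  exact/BSE_norm_bound/CBSE_function.
Qed.

HB.instance Definition _ := @isComBanachAlgebra.Build R (CBSE A)
  CBSE_mul mulA mulC mulDl mulZl normM.

End CBSE_algebra.

Section point_evaluation.
Context {R : realType} (A : comBanachAlgType R).

Lemma point_eval_dual (phi : Delta A) :
  (fun s : CBSE A => s phi : R[i]) \in dual_space (CBSE A).
Proof.
rewrite inE; split=> [c s t //|s].
apply: (@near_normr_re R R[i] (CBSE A) (nbhs s) _ _ _).2 => e e0.
have ss : (id : CBSE A -> CBSE A) @ nbhs s --> s by [].
have se := (@near_normr_re R (CBSE A) (CBSE A) (nbhs s) _ id s).1 ss _ e0.
near=> t; have st : normr_re (s - t) < e by near: t; exact: se.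
apply: le_lt_trans st.
exact: (BSE_norm_pointwise phi (CBSE_function (s - t))).
Unshelve. all: by end_near. Qed.

(* The identification of phi with the functional f_phi : s |-> s phi. *)
Definition point_eval (phi : Delta A) : Dual (CBSE A) :=
  exist _ (fun s : CBSE A => s phi : R[i]) (point_eval_dual phi).

End point_evaluation.

Section hypotheses.
Context {R : realType}.

(* The radical of a commutative Banach algebra is the intersection of the
   kernels of its characters (the whole algebra when there are none). *)
Definition semisimple (A : comBanachAlgType R) : Prop :=
  forall a : A, (forall phi : Delta A, \val phi a = 0) -> a = 0.

Definition directed (I : Type) (le : I -> I -> Prop) : Prop :=
  [/\ inhabited I, forall i, le i i,
      forall i j k, le i j -> le j k -> le i k
    & forall i j, exists k, le i k /\ le j k].

(* x @ net_filter le --> l means that the net x converges to l. *)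
Definition net_filter (I : Type) (le : I -> I -> Prop) : set_system I :=
  [set P | exists i, forall j, le i j -> P j].

Definition has_bwai (A : comBanachAlgType R) : Prop :=
  exists (I : Type) (le : I -> I -> Prop) (x : I -> A),
    [/\ directed le, exists M : R, forall i, normr_re (x i) <= M
      & forall (phi : Delta A) (a : A),
          (fun i => \val phi (bmul (x i) a)) @ net_filter le --> \val phi a].

Definition is_ideal_of (T : Type) (J B : set (T -> R[i])) : Prop :=
  [/\ J `<=` B, J 0,
      forall (c : R[i]) s t, J s -> J t -> J (c *: s + t)
    & forall b s, B b -> J s -> J (b * s)].

End hypotheses.

(* Main.v *)
Require Import Defs.
From HB Require Import structures.
From mathcomp Require Import all_boot all_order all_algebra.
From mathcomp Require Import complex.
From mathcomp Require Import all_classical all_reals topology normedtype sequences.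

Set Implicit Arguments.
Unset Strict Implicit.
Unset Printing Implicit Defensive.

Import Order.TTheory GRing.Theory Num.Theory.
Import numFieldNormedType.Exports.

Local Open Scope classical_set_scope.
Local Open Scope ring_scope.
Local Open Scope complex_scope.

(* Evaluating the functionals at a bounded weak approximate identity shows that
   the constant 1 is a BSE-function, so the ideal C_BSE(Delta A) is all of
   C_b(Delta A); it is therefore closed under conjugation and under inversion of
   functions bounded away from 0. An element t of the kernel of a character f is
   then not bounded away from 0, for otherwise f(1) = f(t) f(1/t) = 0. As
   s conj(s) + t conj(t) is in the kernel when s and t are, the sets
   {|t| < e} with t in ker f generate a proper filter on Delta A, along which
   the point evaluations converge to f. Conversely a weak* limit of point
   evaluations is multiplicative and takes the value 1 at the unit. *)

(** * Weak* convergence as pointwise convergence *)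

Section weak_star.
Context {R : realType} {V : normedModType R[i]}.

Lemma dual_eval_continuous (v : V) :
  continuous (fun f : Dual V => \val f v : R[i]).
Proof.
move=> f.
have valc : (\val : Dual V -> {ptws V -> R[i]}) @ f --> \val f.
  exact: initial_continuous.
apply: (@cvg_comp _ _ _ \val (fun h : {ptws V -> R[i]} => h v) _ _ _ valc).
exact: (@proj_continuous V (fun=> R[i]) v (\val f)).
Qed.

Lemma cvg_dual (T : Type) (F : set_system T) (FF : Filter F)
    (g : T -> Dual V) (f : Dual V) :
  (forall v, (fun x => \val (g x) v : R[i]) @ F --> (\val f v : R[i])) ->
  g @ F --> f.
Proof.
move=> gf.
have valg : (\val \o g : T -> {ptws V -> R[i]}) @ F --> \val f.
  (* The product topology is the supremum of the initial topologies of the evaluations, so each [v]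
     is treated separately; the second half pulls back along [\val]. *)
  apply/cvg_sup => v P [Q [[B Bo <-] Bf BP]]; apply: (filterS BP).
  by apply: gf; exact: open_nbhs_nbhs.
move=> P [Q [[B Bo <-] Bf BP]]; apply: (filterS BP).
by apply: valg; exact: open_nbhs_nbhs.
Qed.

End weak_star.

(** * From the approximate identity to the constant 1 *)

Section bwai.
Context {R : realType} {A : comBanachAlgType R}.

Lemma net_filter_proper (I : Type) (le : I -> I -> Prop) :
  directed le -> ProperFilter (net_filter le).
Proof.
move=> [[i0] lexx le_trans dir]; apply: Build_ProperFilter_ex.
  by move=> P [i Pi]; exists i; exact: Pi.
split=> [|P Q [i Pi] [j Qj]|P Q PQ [i Pi]]; first by exists i0.
  have [k [ik jk]] := dir i j; exists k => l kl.
  by split; [apply: Pi|apply: Qj]; exact: le_trans kl.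
by exists i => j ij; exact/PQ/Pi.
Qed.

(** Dividing [a] by [K] brings it into the unit ball, over which [dual_norm] is a supremum. *)
Lemma comb_le_norm n (phi : 'I_n -> Delta A) (c : 'I_n -> R[i]) (K : R) a :
  0 < K -> normr_re a <= K ->
  normr_re (\sum_(i < n) c i * \val (phi i) a) <=
  K * dual_norm (fun b : A => \sum_(i < n) c i * \val (phi i) b).
Proof.
move=> K0 aK.
have KE (k : R) : 0 < k -> normr_re k%:C = k.
  by move=> k0; rewrite /normr_re ger0_norm ?ler0c ?ltW.
have {1}-> : a = K%:C *: ((K^-1)%:C *: a).
  by rewrite scalerA -rmorphM/= mulfV ?gt_eqF// scale1r.
under eq_bigr do rewrite -[_ *: (_ *: a)]addr0 Delta_lin Delta0 addr0 mulrCA.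
rewrite -mulr_sumr normr_reM KE// ler_wpM2l ?(ltW K0)//.
apply: comb_le; rewrite normr_reZ KE ?invr_gt0//.
by rewrite mulrC ler_pdivrMr// mul1r.
Qed.

(** The sum of the [c j] is the limit of the combinations evaluated at [x i], and these are bounded
    uniformly in [i]. *)
Lemma bwai_BSE_function1 : has_bwai A -> BSE_function A 1.
Proof.
move=> [I [le [x [ledir [M xM] xcvg]]]].
have FF := net_filter_proper ledir.
have M0 : 0 <= M.
  by have [[ i] _ _ _] := ledir; exact: le_trans (normr_re_ge0 _) (xM i).
(* [M] may be 0, while [comb_le_norm] asks for a positive radius. *)
have M1 : 0 < M + 1 by rewrite ltr_wpDl.
have xphi (phi : Delta A) :
    (fun i => \val phi (x i) : R[i]) @ net_filter le --> (1 : R[i]).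
  (* Dividing by a nonzero value [phi a] turns the limit [phi a] into 1. *)
  have [_ _ [a a0]] := Delta_character phi.
  have -> : (fun i => \val phi (x i) : R[i]) =
            (fun i => \val phi (bmul (x i) a) * (\val phi a)^-1).
    by apply/funext => i; rewrite Delta_mul mulfK.
  by rewrite -(mulfV a0); apply: cvgM; [exact: xcvg|exact: cvg_cst].
apply/BSE_functionP; split.
  by move=> phi; exact: (@cvg_cst R[i] 1 (Delta A) (nbhs phi) _).
exists (M + 1); first exact: ltW.
move=> n phi c; apply/ler_addgt0Pr => e e0.
have : (fun i => \sum_(j < n) c j * \val (phi j) (x i)) @ net_filter le -->
       \sum_(j < n) c j * (1 : R[i]).
  apply: cvg_big => [|j _]; first exact: add_continuous.
  by apply: cvgM; [exact: cvg_cst|exact: xphi].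
move=> /(near_normr_re _ _ _).1/(_ _ e0)/filter_ex[i ie].
rewrite -[X in normr_re X](subrK (\sum_(j < n) c j * \val (phi j) (x i))).
rewrite (le_trans (normr_reD _ _))// addrC lerD ?(ltW ie)//.
by apply: comb_le_norm => //; rewrite (le_trans (xM i))// lerDl.
Qed.

End bwai.

(** * Conjugation and inversion of bounded continuous functions *)

Section Cb_theory.
Context {R : realType} {A : comBanachAlgType R}.
Implicit Types s : Delta A -> R[i].

Lemma normr_re_conj (z : R[i]) : normr_re (Num.conj z) = normr_re z.
Proof. by rewrite /normr_re norm_conjC. Qed.

Lemma normr_re_sum_sqr (z w : R[i]) :
  normr_re (z * Num.conj z + w * Num.conj w) =
  normr_re z ^+ 2 + normr_re w ^+ 2.
Proof.
apply: (fmorph_inj (@real_complex R)).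
rewrite rmorphD !rmorphXn/= !normr_reE -!normCK ger0_norm//.
by rewrite addr_ge0 ?exprn_ge0.
Qed.

Lemma Cb_conj s : Cb A s -> Cb A (fun phi => Num.conj (s phi)).
Proof.
move=> [sc [M sM]]; split; last by exists M => phi; rewrite normr_re_conj.
move=> phi.
apply: (@near_normr_re R R[i] (Delta A) (nbhs phi) _ _ _).2 => e e0.
have sphi := (@near_normr_re R R[i] (Delta A) (nbhs phi) _ s (s phi)).1
  (sc phi) _ e0.
near=> psi; rewrite -rmorphB/= normr_re_conj.
by near: psi; exact: sphi.
Unshelve. all: by end_near. Qed.

Lemma Cb_inv s (e : R) : 0 < e -> (forall phi, e <= normr_re (s phi)) ->
  Cb A s -> Cb A (fun phi => (s phi)^-1).
Proof.
move=> e0 es [sc _].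
have s0 phi : s phi != 0.
  by apply/eqP => s0; have := es phi; rewrite s0 normr_re0 leNgt e0.
split.
  move=> phi.
  exact: (@cvgV R[i] (Delta A) (nbhs phi) _ s (s phi) (s0 phi) (sc phi)).
exists e^-1 => phi; have n0 : 0 < normr_re (s phi) by exact: lt_le_trans (es _).
have -> : normr_re (s phi)^-1 = (normr_re (s phi))^-1.
  apply: (mulfI (lt0r_neq0 n0)).
  by rewrite -normr_reM !mulfV ?normr_re1// lt0r_neq0.
by rewrite lef_pV2.
Qed.

End Cb_theory.

(** * Characters as weak* limits of point evaluations *)

Section CBSE_characters.
Context {R : realType} (A : comBanachAlgType R).
Context (BSE1 : BSE_function A 1) (CbBSE : Cb A `<=` BSE_function A).
Implicit Types (s t : CBSE A) (f : CBSE A -> R[i]).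

Let one : CBSE A := MkCBSE (mem_set BSE1).

Lemma bmul1 s : bmul one s = s.
Proof. by apply/val_inj; rewrite /= mul1r. Qed.

Lemma character_one f : character (CBSE A) f -> f one = 1.
Proof.
move=> [_ fM [x fx0]]; apply: (mulIf fx0).
by rewrite mul1r -fM bmul1.
Qed.

Lemma character_ker_small f t (e : R) : character (CBSE A) f -> f t = 0 ->
  0 < e -> exists phi : Delta A, normr_re (t phi) < e.
Proof.
move=> fch ft0 e0; apply: contrapT => /forallNP ht.
have te (phi : Delta A) : e <= normr_re (t phi).
  by rewrite leNgt; apply/negP/ht.
have [tCb _] := CBSE_function t.
(* The inverse of [t] is bounded by the inverse of [e], hence in [Cb], and only through [CbBSE] a
   BSE-function. *)
pose u : CBSE A := MkCBSE (mem_set (CbBSE (Cb_inv e0 te tCb))).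
have tu : bmul t u = one.
  apply/val_inj/funext => phi /=; apply: mulfV.
  by apply/eqP => t0; have := te phi; rewrite t0 normr_re0 leNgt e0.
have := character_one fch; rewrite -tu; have [_ -> _] := fch.
by rewrite ft0 mul0r => /esym/eqP; rewrite oner_eq0.
Qed.

(* Along this filter the point evaluations converge to f, since s - f(s) 1 lies
   in ker f for every s; using a filter avoids an explicit base of weak*
   neighbourhoods. *)
Definition ker_filter f : set_system (Delta A) :=
  [set S | exists2 t : CBSE A, f t = 0 &
     exists2 e : R, 0 < e & [set phi | normr_re (t phi) < e] `<=` S].

Lemma ker_filter_proper f :
  character (CBSE A) f -> ProperFilter (ker_filter f).
Proof.
move=> fch; have [flin fM _] := fch.
have f0 : f 0 = 0.
  by have := flin (-1) 0 0; rewrite scaler0 addr0 mulN1r addNr.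
have fD s t : f (s + t) = f s + f t by rewrite -[s]scale1r flin mul1r scale1r.
apply: Build_ProperFilter_ex.
  move=> S [t ft0 [e e0 tS]]; have [phi] := character_ker_small fch ft0 e0.
  by move=> /tS; exists phi.
split=> [|P Q [s fs [d d0 sP]] [t ft [e e0 tQ]]|P Q PQ [t ft [e e0 tP]]].
- by exists 0 => //; exists 1.
- pose conj s : CBSE A :=
    MkCBSE (mem_set (CbBSE (Cb_conj (proj1 (CBSE_function s))))).
  pose m := Num.min d e; have m0 : 0 < m by rewrite lt_min d0.
  (* At each point this is the sum of the squared moduli, so a value below the square of [m] forces
     both moduli below [m]. *)
  exists (bmul s (conj s) + bmul t (conj t)).
    by rewrite fD !fM fs ft !mul0r addr0.
  exists (m ^+ 2); first by rewrite exprn_gt0.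
  move=> phi /=.
  rewrite -[X in normr_re X < m ^+ 2]/(s phi * Num.conj (s phi) +
                                       t phi * Num.conj (t phi)).
  rewrite normr_re_sum_sqr => stm.
  have small (x y : R) : 0 <= x -> x ^+ 2 + y ^+ 2 < m ^+ 2 -> x < m.
    move=> x0 xym; rewrite -(@ltr_pXn2r _ 2) ?nnegrE ?(ltW m0)//.
    by apply: le_lt_trans xym; rewrite lerDl sqr_ge0.
  split; [apply: sP|apply: tQ] => /=.
    have : normr_re (s phi) < m by apply: small stm; exact: normr_re_ge0.
    by rewrite lt_min => /andP[].
  have : normr_re (t phi) < m.
    by move: stm; rewrite addrC; apply: small; exact: normr_re_ge0.
  by rewrite lt_min => /andP[].
- by exists t => //; exists e => //; exact: subset_trans PQ.
Qed.

(** Continuity is automatic: [character_le] makes [f] contractive. *)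
Lemma character_dual f : character (CBSE A) f -> f \in dual_space (CBSE A).
Proof.
move=> fch; have [flin _ _] := fch; rewrite inE; split=> // s.
have fB t u : f (t - u) = f t - f u.
  by rewrite addrC -scaleN1r flin mulN1r addrC.
apply: (@near_normr_re R R[i] (CBSE A) (nbhs s) _ _ _).2 => e e0.
have ss : (id : CBSE A -> CBSE A) @ nbhs s --> s by [].
have se := (@near_normr_re R (CBSE A) (CBSE A) (nbhs s) _ id s).1 ss _ e0.
near=> t; have st : normr_re (s - t) < e by near: t; exact: se.
by rewrite -fB; exact: le_lt_trans (character_le fch _) st.
Unshelve. all: by end_near. Qed.

Lemma character_closure (F : Dual (CBSE A)) :
  character (CBSE A) (\val F) -> closure (range (@point_eval R A)) F.
Proof.
move=> fch; have [flin _ _] := fch.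
have FF := ker_filter_proper fch.
have cvF : @point_eval R A @ ker_filter (\val F) --> F.
  apply: cvg_dual => s.
  apply: (@near_normr_re R R[i] (Delta A) _ _ _ _).2 => e e0.
  (* The modulus of this kernel element at [phi] is exactly the distance from [s phi] to the value
     of [F] at [s]. *)
  exists (- \val F s *: one + s).
    by rewrite flin character_one// mulr1 addNr.
  exists e => // phi /=.
  by rewrite -normr_reN opprD -scaleNr opprK/= /GRing.scale/= mulr1.
move=> B /cvF FB; have [phi Bphi] := @filter_ex _ _ FF _ FB.
by exists (point_eval phi); split => //; exists phi.
Qed.

Lemma closure_character (F : Dual (CBSE A)) :
  closure (range (@point_eval R A)) F -> character (CBSE A) (\val F).
Proof.
(* By [rG], an identity true of all point evaluations holds near [G], and so passes to the limit. *)
rewrite closureEcvg => -[G GG [GF rG]].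
have Gev s :
    (fun f : Dual (CBSE A) => \val f s : R[i]) @ G --> (\val F s : R[i]).
  exact: cvg_trans (cvg_app _ GF) (@dual_eval_continuous R (CBSE A) s F).
have [Flin _] := set_mem (valP F).
split=> //.
  move=> s t; apply: (@cvg_unique R[i] _ _ _ _ _ (Gev (bmul s t))).
    exact: norm_hausdorff.
  apply: cvg_trans (cvgM (Gev s) (Gev t)); apply: near_eq_cvg.
  by apply: rG => _ [phi _ <-].
(* Being nonzero need not survive a limit, but the value 1 at the unit does. *)
exists one; suff -> : \val F one = 1 by rewrite oner_eq0.
apply: (@cvg_unique R[i] _ _ _ _ _ (Gev one)); first exact: norm_hausdorff.
apply: cvg_trans (@cvg_cst R[i] 1 _ G _); apply: near_eq_cvg.
by apply: rG => _ [phi _ <-].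
Qed.

End CBSE_characters.

Theorem mainTheorem2 (R : realType) (A : comBanachAlgType R)
    (A_semisimple : semisimple A) (A_bwai : has_bwai A)
    (CBSE_ideal : is_ideal_of (BSE_function A) (Cb A)) :
  character (CBSE A) =
  [set \val F | F in closure (range (@point_eval R A))].
Proof.
have BSE1 := bwai_BSE_function1 A_bwai.
have CbBSE : Cb A `<=` BSE_function A.
  move=> b bCb; have [_ _ _ mulI] := CBSE_ideal.
  (* An ideal containing 1 contains [b * 1]. *)
  by rewrite -[b]mulr1; exact: mulI.
apply/seteqP; split=> [f fch|_ [F clF <-]]; last exact: closure_character.
pose F : Dual (CBSE A) := exist _ f (character_dual fch).
by exists F => //; exact: character_closure.
Qed.
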